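(* There exists an absolute constant $C>0$ such that for every integer $d\ge 1$ the oriented hypercube $\vec{Q}_d$ satisfies $$\vec{r}(\vec{Q}_d) \leq C\, d^3\, 17^{d}.$$
   Context: The oriented hypercube $\vec{Q}_d$ is the digraph with vertex set $\{0,1\}^d$ in which there is an edge from $u$ to $v$ exactly when $v$ is obtained from $u$ by changing a single coordinate from $0$ to $1$. A tournament on $N$ vertices is an orientation of the edges of the complete graph $K_N$. For an acyclic digraph $D$, the oriented Ramsey number $\vec{r}(D)$ is the minimum $N$ such that every tournament on $N$ vertices contains a copy of $D$, i.e. $D$ as a (not necessarily induced) subdigraph. *)

(* Defs.v *)
From mathcomp Require Import all_boot all_order all_algebra.
From mathcomp Require Import reals.

Set Implicit Arguments.
Unset Strict Implicit.
Unset Printing Implicit Defensive.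

(* A digraph on T is an edge relation D : rel T. A tournament has no loops, and
   [(+)] is exclusive or: exactly one orientation of each pair is present. *)
Definition tournament (V : finType) (t : rel V) : Prop :=
  irreflexive t /\ forall x y : V, x != y -> t x y (+) t y x.

(* Copies are subdigraphs that need not be induced: non-edges are unconstrained. *)
Definition contains_copy (T V : finType) (D : rel T) (t : rel V) : Prop :=
  exists2 f : T -> V, injective f & forall x y : T, D x y -> t (f x) (f y).

Definition all_tournaments_contain (T : finType) (D : rel T) (N : nat) : Prop :=
  forall (V : finType) (t : rel V),
    #|V| = N -> tournament t -> contains_copy D t.

(* The oriented Ramsey number as a (functional) relation, because the minimum
   exists only for acyclic D. [is_oriented_ramsey D N] asserts both that the
   minimum exists and that it equals N. *)
Definition is_oriented_ramsey (T : finType) (D : rel T) (N : nat) : Prop :=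
  all_tournaments_contain D N /\
  forall M : nat, all_tournaments_contain D M -> (N <= M)%N.

Definition oriented_hypercube (d : nat) : rel {ffun 'I_d -> bool} :=
  fun u v =>
    [exists i : 'I_d,
      [&& ~~ u i, v i & [forall j : 'I_d, (j != i) ==> (u j == v j)]]].

Arguments oriented_hypercube d : clear implicits.

(* Main.v *)
Require Import Defs.
From mathcomp Require Import all_boot all_order all_algebra.
From mathcomp Require Import reals.
From mathcomp Require Import boolp zify.

(* Order the tournament by a list maximizing the number of forward edges: every
   vertex is then dominated by at least half of any interval that ends just
   before it. Working backwards, choose disjoint blocks B_d, ..., B_0, the block
   B_j of size about d^2 16^j C(d,j) being cut out of an interval that lies just
   before B_(j+1) and is 4d times longer than B_(j+1). Subsets A_j of B_j, of size
   about d^2 4^j C(d,j), are obtained by dependent random choice: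
   A_j is the common in-neighbourhood in B_j of 2(j+1) random vertices of A_(j+1),
   so that few (j+1)-tuples of A_j have fewer than (d+1) C(d,j+1) common
   out-neighbours in A_(j+1). Layer j of the cube is embedded greedily in A_j.
   The number of vertices used is at most a constant times
   d * sum_j d^2 16^j C(d,j) = d^3 17^d. *)

Set Implicit Arguments.
Unset Strict Implicit.
Unset Printing Implicit Defensive.

(** * Median orders and averaging over intervals *)

Fixpoint forward_edges (V : eqType) (t : rel V) (s : seq V) : nat :=
  if s is x :: s' then count (t x) s' + forward_edges t s' else 0.

Definition median_order (V : finType) (t : rel V) (s : seq V) : Prop :=
  perm_eq s (enum V) /\
  forall s', perm_eq s' (enum V) -> forward_edges t s' <= forward_edges t s.

Lemma exists_median_order (V : finType) (t : rel V) : exists s, median_order t s.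
Proof.
have bnd s : forward_edges t s <= size s * size s.
  elim: s => //= x s IH.
  have := count_size (t x) s; nia.
pose P (n : nat) := has (fun s => forward_edges t s == n) (permutations (enum V)).
have exP : exists n, P n.
  exists (forward_edges t (enum V)); apply/hasP; exists (enum V) => //.
  by rewrite mem_permutations.
have ubP n : P n -> n <= size (enum V) * size (enum V).
  case/hasP => s; rewrite mem_permutations => /perm_size <- /eqP <-; exact: bnd.
case: (ex_maxnP exP ubP) => n /hasP[s]; rewrite mem_permutations => ps /eqP <- maxn.
exists s; split => // s' ps'; apply: maxn; apply/hasP; exists s' => //.
by rewrite mem_permutations.
Qed.

Lemma forward_edges_cat (V : eqType) (t : rel V) (s1 s2 : seq V) :
  forward_edges t (s1 ++ s2) =
  forward_edges t s1 + \sum_(x <- s1) count (t x) s2 + forward_edges t s2.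
Proof.
elim: s1 => [|x s1 IH] /=; first by rewrite big_nil.
by rewrite IH count_cat big_cons; lia.
Qed.

(** Moving [x] to the front of [b] affects only the pairs formed by [x] and a vertex of [b]: it
    turns the edges from [b] to [x] backward and those from [x] to [b] forward. By maximality the
    latter are not more numerous. *)
Lemma median_order_indeg (V : finType) (t : rel V) (s a b c : seq V) (x : V) :
  tournament t -> median_order t s -> s = a ++ b ++ x :: c ->
  size b <= 2 * count (t^~ x) b.
Proof.
move=> [_ tt] [ps maxs] sE.
have us : uniq s by rewrite (perm_uniq ps) enum_uniq.
have pE : perm_eq (a ++ x :: b ++ c) s.
  by rewrite sE perm_cat2l -cat1s perm_catCA.
have := maxs _ (perm_trans pE ps).
rewrite sE !forward_edges_cat /= !forward_edges_cat /=.
have cs p : count p (x :: b ++ c) = count p (b ++ x :: c).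
  by rewrite /= !count_cat /=; lia.
have -> : \sum_(i <- a) count (t i) (x :: b ++ c) = \sum_(i <- a) count (t i) (b ++ x :: c).
  by apply: eq_bigr => i _; rewrite cs.
have -> : \sum_(i <- b) count (t i) (x :: c) = count (t^~ x) b + \sum_(i <- b) count (t i) c.
  rewrite -sum1_count [X in _ = X + _]big_mkcond -big_split /=.
  by apply: eq_bigr => i _ /=; case: (t i x).
rewrite count_cat.
suff -> : count (t^~ x) b = size b - count (t x) b.
  by have := count_size (t x) b; lia.
have xb : x \notin b.
  move: us; rewrite sE !cat_uniq => /and3P[_ _ /and3P[_ H _]].
  by move: H; rewrite /= negb_or => /andP[].
rewrite -(count_predC (t x) b) addKn; apply: eq_in_count => y yb /=.
have nxy : x != y by apply: contraNneq xb => ->.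
by have := tt _ _ nxy; case: (t x y); case: (t y x).
Qed.

(** Pigeonhole on the [L] consecutive pieces of length [w]: if the first piece is too light, the
    remaining ones still have a large enough average. *)
Lemma exists_heavy_block (V : Type) (f : V -> nat) (w K L : nat) (v : seq V) :
  0 < L -> size v = L * w -> L * K <= \sum_(x <- v) f x ->
  exists v1 b v2, [/\ v = v1 ++ b ++ v2, size b = w & K <= \sum_(x <- b) f x].
Proof.
case: L => // L _; elim: L v => [|L IH] v sv le.
  by exists [::], v, [::]; rewrite cats0 sv !mul1n in le *.
case: (leqP K (\sum_(x <- take w v) f x)) => [le1|lt].
  exists [::], (take w v), (drop w v); split => //; first by rewrite cat_take_drop.
  by rewrite size_take sv; case: ltnP => //; nia.
have /IH : size (drop w v) = L.+1 * w by rewrite size_drop sv; nia.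
case=> [|v1 [b [v2 [E sb Kb]]]].
  by move: le; rewrite -{1}(cat_take_drop w v) big_cat /=; nia.
by exists (take w v ++ v1), b, v2; split => //; rewrite -catA -E cat_take_drop.
Qed.

(** * Counting tuples and power inequalities *)

(** Number of ways to append [n] vertices to [p], repetitions allowed, and obtain a tuple satisfying
    [P]. *)
Fixpoint ext_count (V : finType) (P : pred (seq V)) (n : nat) (p : seq V) : nat :=
  if n is m.+1 then \sum_(v : V) ext_count P m (rcons p v) else P p.

(** Markov's inequality. It bounds the number of images that a greedy step must avoid. *)
Lemma few_rich_extensions (V : finType) (P : pred (seq V)) (m n : nat) (p : seq V) :
  ext_count P n.+1 p < m ^ n.+1 ->
  #|[set v | m ^ n <= ext_count P n (rcons p v)]| < m.
Proof.
move=> H; have m0 : 0 < m by case: m H => //; rewrite exp0n.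
rewrite -(ltn_pmul2r (m := m ^ n)) ?expn_gt0 ?m0 // -expnS.
apply: leq_ltn_trans H => /=.
rewrite -sum_nat_const big_mkcond /=.
by apply: leq_sum => v _; rewrite inE; case: ifP.
Qed.

Lemma sum_ext_count_le (V I : finType) (D : {pred I}) (P : I -> pred (seq V))
    (Q : pred (seq V)) (K n : nat) (p : seq V) :
  (forall q, \sum_(i in D) P i q <= K * Q q) ->
  \sum_(i in D) ext_count (P i) n p <= K * ext_count Q n p.
Proof.
move=> H; elim: n p => [|n IH] p //=.
rewrite exchange_big big_distrr /=.
by apply: leq_sum => v _; apply: IH.
Qed.

Lemma ext_count_all (V : finType) (B : {set V}) (n : nat) (p : seq V) :
  ext_count (all (mem B)) n p = all (mem B) p * #|B| ^ n.
Proof.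
elim: n p => [|n IH] p /=; first by rewrite expn0 muln1.
under eq_bigr => v _ do rewrite IH all_rcons.
rewrite -big_distrl /= expnS mulnA; congr (_ * _).
rewrite -sum1_card big_distrr /= [RHS]big_mkcond /=.
by apply: eq_bigr => v _; case: (v \in B); rewrite ?muln1.
Qed.

(** Chebyshev's sum inequality: doubled and summed over pairs, it reduces to
    [(x i ^ n - x j ^ n) * (x i - x j)] being nonnegative. *)
Lemma chebyshev_sum_expn (I : finType) (D : {pred I}) (x : I -> nat) (n : nat) :
  (\sum_(i in D) x i ^ n) * (\sum_(i in D) x i) <= #|D| * \sum_(i in D) x i ^ n.+1.
Proof.
have twice a b : (a + a <= b + b) -> a <= b by lia.
apply: twice.
have E1 : \sum_(i in D) \sum_(j in D) (x i ^ n * x j) =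
   (\sum_(i in D) x i ^ n) * (\sum_(i in D) x i).
  by rewrite big_distrl /=; apply: eq_bigr => i _; rewrite big_distrr.
have E2 : \sum_(i in D) \sum_(j in D) x j ^ n.+1 = #|D| * \sum_(i in D) x i ^ n.+1.
  by rewrite sum_nat_const.
rewrite -E1 -E2 {2}exchange_big [X in _ <= X + _]exchange_big -!big_split /=.
apply: leq_sum => i _; rewrite -!big_split /=; apply: leq_sum => j _.
rewrite !expnS.
have mono a b : a <= b -> a ^ n <= b ^ n by case: (n) => // k; rewrite leq_exp2r.
by case: (leqP (x i) (x j)) => [|/ltnW] /[dup] /mono; nia.
Qed.

Lemma power_mean_nat (I : finType) (D : {pred I}) (x : I -> nat) (n : nat) :
  (\sum_(i in D) x i) ^ n.+1 <= #|D| ^ n * \sum_(i in D) x i ^ n.+1.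
Proof.
elim: n => [|n IH].
  by rewrite expn1 expn0 mul1n; apply: leq_sum => i _; rewrite expn1.
rewrite expnSr; apply: leq_trans (leq_mul IH (leqnn _)) _.
rewrite -mulnA [X in _ <= X * _]expnSr -mulnA leq_mul2l.
by rewrite chebyshev_sum_expn orbT.
Qed.

(** Bernoulli: (1 - 1/(4d))^t >= 1 - t/(4d) >= 1/2. [H] is the first inequality with denominators
    cleared. *)
Lemma bernoulli_half (d t : nat) : t <= 2 * d -> (4 * d) ^ t <= 2 * (4 * d - 1) ^ t.
Proof.
case: d => [|d] le; first by case: t le.
have H : (4 * d.+1 - t) * (4 * d.+1) ^ t <= 4 * d.+1 * (4 * d.+1 - 1) ^ t.
  elim: t le => [|t IH] le; first by rewrite subn0.
  have {IH} := IH (ltnW le); rewrite !expnS.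
  set X := _ ^ t; set Y := _ ^ t => IH.
  have -> : 4 * d.+1 * ((4 * d.+1 - 1) * Y) = (4 * d.+1 - 1) * (4 * d.+1 * Y) by lia.
  apply: leq_trans (leq_mul (leqnn _) IH).
  rewrite !mulnA leq_mul2r; apply/orP; right.
  have : t < 4 * d.+1 by lia.
  rewrite -(mulnA _ 4); move: (4 * d.+1) => D /subnK <-; move: (D - t.+1) => u.
  have -> : u + t.+1 - 1 = u + t by lia.
  have -> : u + t.+1 - t = u.+1 by lia.
  by rewrite addnK; nia.
rewrite -(leq_pmul2l (m := 2 * d.+1)) //.
apply: leq_trans (_ : (4 * d.+1 - t) * (4 * d.+1) ^ t <= _).
  by rewrite leq_mul2r; apply/orP; right; lia.
by apply: leq_trans H _; rewrite !mulnA leq_mul2r; apply/orP; right; lia.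
Qed.

(** * Dependent random choice *)

Definition common_out (V : finType) (t : rel V) (A : {set V}) (p : seq V) : {set V} :=
  [set v in A | all (t^~ v) p].

Definition poor (V : finType) (t : rel V) (A B : {set V}) (s : nat) : pred (seq V) :=
  fun p => all (mem B) p && (#|common_out t A p| < s).

(** Exchange of roles: [p] lies in the common in-neighbourhood of [T] exactly when [T] lies in the
    common out-neighbourhood of [p]. *)
Lemma card_all_common_out (V : finType) (t : rel V) (A : {set V}) (p : seq V) k :
  #|[set T : {ffun 'I_k -> V} in ffun_on (mem A) | all (fun x => [forall i, t x (T i)]) p]| =
  #|common_out t A p| ^ k.
Proof.
rewrite -[in RHS](card_ord k) -card_ffun_on.
apply: eq_card => T; rewrite !inE.
apply/andP/ffun_onP.
  move=> [/ffun_onP TA /allP Tp] i; rewrite inE TA /=.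
  by apply/allP => x /Tp /forallP.
move=> H; split; first by apply/ffun_onP => i; have := H i; rewrite inE => /andP[].
apply/allP => x xp; apply/forallP => i.
by have := H i; rewrite inE => /andP[_ /allP]; apply.
Qed.

(* Dependent random choice: the common in-neighbourhood in B of a uniformly
   random 2n-tuple T of vertices of A is large on average, and contains few poor
   n-tuples on average; some T does well on both counts. *)
Lemma dependent_random_choice (V : finType) (t : rel V) (A B : {set V}) (d n s m a : nat) :
  0 < n <= d -> 0 < s -> 0 < a ->
  #|B| = 4 ^ n.+1 * a ->
  #|A| * #|B| * (4 * d - 1) <= 8 * d * \sum_(b in B) #|common_out t A [:: b]| ->
  32 * (#|B| * s ^ 2) <= m * #|A| ^ 2 ->
  exists B' : {set V}, [/\ B' \subset B, a <= #|B'| &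
    ext_count (poor t A B' s) n [::] < m ^ n].
Proof.
move=> /andP[n0 nd] s0 a0 cB dens Hm.
(* With 2n random vertices, a poor tuple survives with probability at most (s/#|A|)^(2n), an n-th
   power comparable with [m ^ n]; also [k <= 2 * d], as [bernoulli_half] requires. *)
set k := 2 * n.
have k0 : 0 < k by rewrite muln_gt0.
pose NB (T : {ffun 'I_k -> V}) := [set b in B | [forall i, t b (T i)]].
pose bad T := ext_count (poor t A (NB T) s) n [::].
have [[T [_ aT bT]]|no] : (exists T, [/\ T \in ffun_on (mem A), a <= #|NB T| & bad T < m ^ n]) \/
   forall T, T \in ffun_on (mem A) -> (#|NB T| < a) || (m ^ n <= bad T).
  case: (boolP [exists T in ffun_on (mem A), (a <= #|NB T|) && (bad T < m ^ n)]).
    by move=> /exists_inP[T TA /andP[]]; left; exists T.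
  rewrite negb_exists_in => /forall_inP H; right => T TA.
  by have := H T TA; rewrite negb_and -ltnNge -leqNgt.
  exists (NB T); split => //.
  by apply/subsetP => b; rewrite inE => /andP[].
exfalso.
have B0 : 0 < #|B| by rewrite cB muln_gt0 expn_gt0.
set w := #|B| in B0 *; set x := #|A|.
have sumN : \sum_(T in ffun_on (mem A)) #|NB T| = \sum_(b in B) #|common_out t A [:: b]| ^ k.
  transitivity (\sum_(T in ffun_on (mem A)) \sum_(b in B) nat_of_bool [forall i : 'I_k, t b (T i)]).
    apply: eq_bigr => T _; rewrite -sum1_card big_mkcond [RHS]big_mkcond /=.
    by apply: eq_bigr => b _; rewrite inE; case: (b \in B) => //=; case: ifP.
  rewrite exchange_big /=; apply: eq_bigr => b _.
  rewrite -card_all_common_out -sum1_card big_mkcond [RHS]big_mkcond /=.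
  apply: eq_bigr => T _; rewrite in_set /=.
  by case: (T \in _) => //=; rewrite andbT; case: ifP.
(* A poor tuple survives only for those [T] inside its common out-neighbourhood, hence for at most
   [s ^ k] of them. *)
have sumbad : \sum_(T in ffun_on (mem A)) bad T <= s ^ k * w ^ n.
  rewrite -[w ^ n]mul1n -[1]/(nat_of_bool (all (mem B) [::])) -ext_count_all.
  apply: sum_ext_count_le => q; case: (boolP (#|common_out t A q| < s)) => lt; last first.
    by rewrite big1 // => T _; rewrite /poor (negbTE lt) andbF.
  case: (boolP (all (mem B) q)) => qB; last first.
    rewrite big1 // => T _; rewrite /poor; case: (boolP (all _ _)) => //= /allP H.
    by case/negP: qB; apply/allP => b /H; rewrite /= inE => /andP[].
  rewrite muln1; apply: leq_trans (_ : #|common_out t A q| ^ k <= _).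
    rewrite -card_all_common_out -sum1_card big_mkcond [X in _ <= X]big_mkcond /=.
    apply: leq_sum => T _; rewrite in_set; case: (T \in _) => //=.
    rewrite /poor lt andbT; case: (boolP (all (mem _) q)) => // /allP H.
    suff -> : all (fun b => [forall i, t b (T i)]) q by [].
    by apply/allP => b /H /=; rewrite inE => /andP[].
  by rewrite leq_exp2r //; apply: ltnW.
(* By the power mean inequality, the average of [#|NB T|] is at least w times the k-th power of
   (1/2)(1 - 1/(4d)), hence at least w / (2 * 2^k). *)
have sumA : x ^ k * w <= 2 * 2 ^ k * \sum_(T in ffun_on (mem A)) #|NB T|.
  rewrite sumN; set S := \sum_(b in B) _ ^ k.
  have Jen : (\sum_(b in B) #|common_out t A [:: b]|) ^ k <= w ^ k.-1 * S.
    have kE : k = k.-1.+1 by rewrite prednK.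
    by rewrite /S {1 3}kE; apply: power_mean_nat.
  have d0 : 0 < d by apply: leq_trans nd.
  rewrite -(leq_pmul2l (m := (4 * d) ^ k * w ^ k.-1)); last first.
    by rewrite muln_gt0 !expn_gt0 B0 !muln_gt0 d0.
  have -> : (4 * d) ^ k * w ^ k.-1 * (x ^ k * w) = (x * w) ^ k * (4 * d) ^ k.
    rewrite !expnMn; have -> : w ^ k = w * w ^ k.-1 by rewrite -expnS prednK.
    by lia.
  apply: leq_trans (leq_mul (leqnn _) (_ : _ <= 2 * (4 * d - 1) ^ k)) _.
    by apply: bernoulli_half; rewrite /k leq_mul2l nd.
  rewrite mulnCA -expnMn.
  apply: leq_trans (_ : 2 * (8 * d * \sum_(b in B) #|common_out t A [:: b]|) ^ k <= _).
    by rewrite leq_mul2l leq_exp2r ?dens.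
  rewrite expnMn.
  have -> : (8 * d) ^ k = 2 ^ k * (4 * d) ^ k by rewrite -expnMn; congr (_ ^ _); lia.
  have : (2 * (2 ^ k * (4 * d) ^ k)) * (\sum_(b in B) #|common_out t A [:: b]|) ^ k <=
      (2 * (2 ^ k * (4 * d) ^ k)) * (w ^ k.-1 * S) by rewrite leq_mul2l Jen orbT.
  by lia.
(* Every [T] fails: either [#|NB T|] is below [a], or [bad T] is at least [m ^ n] while [#|NB T|] is
   at most [w]. *)
have sumno : m ^ n * (\sum_(T in ffun_on (mem A)) #|NB T|) <=
    x ^ k * (a * m ^ n) + w * (s ^ k * w ^ n).
  apply: leq_trans (_ : \sum_(T in ffun_on (mem A)) (a * m ^ n + w * bad T) <= _).
    rewrite big_distrr /=; apply: leq_sum => T /no /orP[lt|le].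
      by rewrite mulnC; apply: leq_trans (leq_addr _ _); rewrite leq_mul2r ltnW ?orbT.
    apply: leq_trans (leq_addl _ _); rewrite mulnC; apply: leq_mul => //.
    by apply/subset_leq_card/subsetP => b; rewrite inE => /andP[].
  rewrite big_split /= sum_nat_const card_ffun_on card_ord -big_distrr /= leq_add2l.
  by rewrite leq_mul2l sumbad orbT.
have wE : w = 4 * 2 ^ k * a by rewrite /w cB /k expnM expnS.
(* As [w] is [4 * 2 ^ k * a], the term with [a] accounts for only half of the lower bound [sumA];
   the poor tuples must supply the other half. With [up] this forces 8^n <= 4, which is absurd. *)
have {no} key : m ^ n * x ^ k <= 4 * 2 ^ k * (s ^ k * w ^ n).
  have H1 := leq_mul (leqnn (m ^ n)) sumA.
  have H2 := leq_mul (leqnn (2 * 2 ^ k)) sumno.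
  rewrite -(leq_pmul2r B0).
  have E : w * (m ^ n * x ^ k) = 2 * (2 * 2 ^ k * (x ^ k * (a * m ^ n))) by rewrite wE; lia.
  move: H1 H2 E; move: (m ^ n) (x ^ k) (2 ^ k) (s ^ k) (w ^ n) => M X K S W.
  move: (\sum_(T in _) _) => Z H1 H2 E; lia.
have up : 8 ^ n * (4 * (w * s ^ 2)) ^ n <= m ^ n * x ^ k.
  rewrite /k expnM -!expnMn leq_exp2r //.
  by apply: leq_trans Hm; rewrite mulnA.
have e : 4 * 2 ^ k * (s ^ k * w ^ n) = 4 * (4 * (w * s ^ 2)) ^ n.
  by rewrite /k ![_ ^ (2 * n)]expnM !expnMn [_ * w ^ n]mulnC -mulnA.
have : 8 ^ n * (4 * (w * s ^ 2)) ^ n <= 4 * (4 * (w * s ^ 2)) ^ n.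
  by rewrite -e; apply: leq_trans up key.
rewrite leq_pmul2r; last by rewrite expn_gt0 !muln_gt0 B0 s0.
rewrite leqNgt => /negP; apply.
by apply: leq_trans (_ : 8 ^ 1 <= _) => //; rewrite leq_exp2l.
Qed.

(** * Ranks, degrees and layers of the hypercube *)

Definition support_set (d : nat) (u : {ffun 'I_d -> bool}) : {set 'I_d} := [set i | u i].

Definition set_coord (d : nat) (u : {ffun 'I_d -> bool}) (i : 'I_d) (b : bool) :
  {ffun 'I_d -> bool} := [ffun j => if j == i then b else u j].

Lemma oriented_hypercubeP (d : nat) (u v : {ffun 'I_d -> bool}) :
  reflect (exists i, [/\ ~~ u i, v i & forall j, j != i -> u j = v j])
    (oriented_hypercube d u v).
Proof.
apply: (iffP existsP) => -[i].
  move=> /and3P[ui vi /forallP H]; exists i; split => // j ji.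
  by have := H j; rewrite ji => /eqP.
case=> ui vi H; exists i; rewrite ui vi /=; apply/forallP => j; apply/implyP => ji.
by rewrite H.
Qed.

Lemma oriented_hypercube_rank (d : nat) (u v : {ffun 'I_d -> bool}) :
  oriented_hypercube d u v -> #|support_set v| = #|support_set u|.+1.
Proof.
case/oriented_hypercubeP => i [ui vi H].
have -> : support_set v = i |: support_set u.
  by apply/setP => j; rewrite !inE; case: (eqVneq j i) => [->|/H ->].
by rewrite cardsU1 inE ui.
Qed.

Lemma oriented_hypercube_indegree (d : nat) (v : {ffun 'I_d -> bool}) :
  #|[set u | oriented_hypercube d u v]| = #|support_set v|.
Proof.
have -> : [set u | oriented_hypercube d u v] = [set set_coord v i false | i in support_set v].
  apply/setP => u; rewrite inE; apply/oriented_hypercubeP/imsetP => -[i].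
    case=> ui vi H; exists i; rewrite ?inE //; apply/ffunP => j; rewrite ffunE.
    by case: (eqVneq j i) => [->|/H //]; apply: negbTE.
  rewrite inE => vi ->; exists i; split => [||j ji]; rewrite ?ffunE ?eqxx //.
  by rewrite (negbTE ji).
apply: card_in_imset => i j; rewrite !inE => vi vj /ffunP /(_ i).
by rewrite !ffunE eqxx; case: (eqVneq i j) => // _ /esym; rewrite vi.
Qed.

Lemma oriented_hypercube_outdegree (d : nat) (u : {ffun 'I_d -> bool}) :
  #|[set v | oriented_hypercube d u v]| <= d.
Proof.
apply: leq_trans (_ : #|[set set_coord u i true | i in 'I_d]| <= d); last first.
  by apply: leq_trans (leq_imset_card _ _) _; rewrite card_ord.
apply/subset_leq_card/subsetP => v; rewrite inE => /oriented_hypercubeP[i [_ vi H]].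
apply/imsetP; exists i => //; apply/ffunP => j; rewrite ffunE.
by case: (eqVneq j i) => [->|/H].
Qed.

Lemma card_hypercube_layer (d k : nat) :
  #|[set u : {ffun 'I_d -> bool} | #|support_set u| == k]| = 'C(d, k).
Proof.
have inj : injective (@support_set d).
  by move=> u v /setP E; apply/ffunP => i; have := E i; rewrite !inE.
rewrite -(card_imset _ inj) -[in RHS](card_ord d) -card_draws.
apply: eq_card => X; rewrite !inE; apply/imsetP/idP => [[u]|Xk].
  by rewrite inE => uk ->.
have E : support_set [ffun i => i \in X] = X by apply/setP => i; rewrite inE ffunE.
by exists [ffun i => i \in X]; rewrite ?inE E.
Qed.

(** * Greedy embedding of a graded digraph *)

Lemma topological_enum (T : finType) (D : rel T) (r : T -> nat) :
  (forall x y, D x y -> r x < r y) ->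
  exists e : seq T, [/\ uniq e, forall x, x \in e &
    forall p x q z, e = p ++ x :: q -> D z x -> z \in p].
Proof.
move=> Dr; pose le x y := r x <= r y.
have tle : transitive le by move=> y x z; apply: leq_trans.
exists (sort le (enum T)); split.
- by rewrite sort_uniq enum_uniq.
- by move=> x; rewrite mem_sort mem_enum.
move=> p x q z E Dzx.
have : z \in sort le (enum T) by rewrite mem_sort mem_enum.
have : sorted le (sort le (enum T)) by apply: sort_sorted => a b; apply: leq_total.
rewrite E sorted_pairwise // pairwise_cat /= => /and3P[_ _ /andP[/allP xq _]].
rewrite mem_cat inE => /or3P[//|/eqP zx|/xq].
  by have := Dr _ _ Dzx; rewrite zx ltnn.
by rewrite /le leqNgt Dr.
Qed.

(* Vertices are embedded in order of rank. The in-neighbourhood of y is always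
   kept completable: only a small proportion of the ways to embed its remaining
   vertices leads to a poor tuple, so once it is entirely embedded, it is not
   poor and y has many candidate images. *)
Lemma graded_embedding (T V : finType) (D : rel T) (t : rel V) (r : T -> nat)
    (A : nat -> {set V}) (m s : nat -> nat) (k : nat) :
  (forall x y, D x y -> r y = (r x).+1) ->
  (forall y, #|[set x | D x y]| = r y) ->
  (forall x, #|[set y | D x y]| <= k) ->
  (forall x, #|[set z | r z == r x]| + k * m (r x) <= s (r x)) ->
  (forall x y, r x != r y -> [disjoint A (r x) & A (r y)]) ->
  s 0 <= #|A 0| ->
  (forall y i, r y = i.+1 ->
     ext_count (poor t (A i.+1) (A i) (s i.+1)) i.+1 [::] < m i ^ i.+1) ->
  V -> contains_copy D t.
Proof.
move=> rD inD outD ms disjA sA0 count0 v0.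
have [e [ue eT topo]] : exists e : seq T, [/\ uniq e, forall x, x \in e &
    forall p x q z, e = p ++ x :: q -> D z x -> z \in p].
  by apply: (topological_enum (r := r)) => x y /rD ->.
pose P y := poor t (A (r y)) (A (r y).-1) (s (r y)).
(* The images of those in-neighbours of [y] that are already embedded, [p] being the embedded prefix
   of [e]. *)
pose L (f : T -> V) (p : seq T) y := [seq f x | x <- p & D x y].
have main p q : e = p ++ q -> exists f : T -> V, [/\ {in p &, injective f},
    {in p, forall x, f x \in A (r x)}, {in p &, forall x y, D x y -> t (f x) (f y)} &
    forall y, 0 < r y -> ext_count (P y) (r y - size (L f p y)) (L f p y) <
      m (r y).-1 ^ (r y - size (L f p y))]; last first.
  have [f [injf _ fD _]] := main e [::] (esym (cats0 e)).
  exists f => [x y|x y]; [exact: injf | exact: fD].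
elim/last_ind: p q => [|p x IH] q E.
  exists (fun=> v0); split => // y y0; rewrite subn0.
  by case E1 : (r y) y0 => [|i] // _; rewrite /P E1; apply: (count0 y).
rewrite cat_rcons in E.
have [f [injf fA fD fL]] := IH _ E.
have up : uniq (rcons p x) by move: ue; rewrite E -cat_rcons cat_uniq => /andP[].
have xp : x \notin p by move: up; rewrite rcons_uniq => /andP[].
have {}up : uniq p by move: up; rewrite rcons_uniq => /andP[].
have inp z : D z x -> z \in p by apply: topo E.
have sizeL y : size (L f p y) = #|[set z in p | D z y]|.
  rewrite size_map -(card_uniqP (filter_uniq _ up)).
  by apply: eq_card => z; rewrite mem_filter !inE andbC.
pose C := common_out t (A (r x)) (L f p x).
(* All in-neighbours of [x] are embedded, so the invariant reads [ext_count] < m^0 = 1: their image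
   tuple is not poor. At rank 0 the tuple is empty and [C] is all of [A 0]. *)
have sC : s (r x) <= #|C|.
  have szL : size (L f p x) = r x.
    rewrite sizeL -inD; apply: eq_card => z; rewrite !inE.
    by case: (boolP (D z x)) => [/inp ->|]; rewrite ?andbF.
  case: (posnP (r x)) => [rx0|rx].
    have {}szL := etrans szL rx0; move/size0nil: szL => L0.
    rewrite /C L0 rx0; apply: leq_trans sA0 (subset_leq_card _).
    by apply/subsetP => v vA; rewrite inE vA.
  have := fL x rx; rewrite szL subnn expn0 /= ltnS leqn0 eqb0 /P /poor negb_and -leqNgt.
  case/orP=> // /negP[]; apply/allP => v /mapP[z]; rewrite mem_filter => /andP[Dzx zp] ->.
  by rewrite (rD _ _ Dzx) /=; apply: fA.
(* Two kinds of images are forbidden: [U], already used in the layer of [x] (other layers live in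
   disjoint sets), and [W y], which would break the invariant at an out-neighbour [y]. The bound on
   [U] is strict because [x] is not yet embedded, and this leaves a free candidate. *)
pose U := [set f z | z in [set z in p | r z == r x]].
have cU : #|U| < #|[set z | r z == r x]|.
  apply: leq_ltn_trans (leq_imset_card _ _) _; apply: proper_card; apply/properP; split.
    by apply/subsetP => z; rewrite !inE => /andP[].
  by exists x; rewrite !inE ?eqxx // (negbTE xp).
pose W y := [set v | m (r y).-1 ^ (r y - size (L f p y)).-1 <=
   ext_count (P y) (r y - size (L f p y)).-1 (rcons (L f p y) v)].
have ltL y : D x y -> size (L f p y) < r y.
  move=> Dxy; rewrite sizeL -inD; apply: proper_card; apply/properP; split.
    by apply/subsetP => z; rewrite !inE => /andP[].
  by exists x; rewrite !inE // (negbTE xp).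
have cW y : D x y -> #|W y| <= m (r x).
  move=> Dxy; have y0 : 0 < r y by rewrite (rD _ _ Dxy).
  have -> : m (r x) = m (r y).-1 by rewrite (rD _ _ Dxy).
  apply: ltnW; apply: few_rich_extensions.
  by rewrite prednK ?subn_gt0 ?ltL //; apply: fL.
pose WW := \bigcup_(y in [set y | D x y]) W y.
have cWW : #|WW| <= k * m (r x).
  apply: leq_trans (_ : \sum_(y in [set y | D x y]) m (r x) <= _).
    apply: (big_ind2 (fun (X : {set V}) n => #|X| <= n)) => [|X n Y n' le le'|y].
    - by rewrite cards0.
    - by apply: leq_trans (leq_card_setU X Y).1 _; apply: leq_add.
    by rewrite inE; apply: cW.
  by rewrite sum_nat_const leq_mul2r outD orbT.
have [v vC vUW] : exists2 v, v \in C & v \notin U :|: WW.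
  apply/subsetPn; apply: contraL (leq_trans (ms x) sC) => /subset_leq_card le.
  rewrite -ltnNge; apply: leq_ltn_trans le _.
  apply: leq_ltn_trans (leq_card_setU _ _).1 _.
  by rewrite -addSn leq_add.
move: vUW; rewrite !inE negb_or => /andP[vU vW].
move: vC; rewrite inE => /andP[vA /allP vL].
pose g z := if z == x then v else f z.
have gx : g x = v by rewrite /g eqxx.
have gp z : z \in p -> g z = f z by move=> zp; rewrite /g; case: eqP zp xp => // -> ->.
have gL y : L g (rcons p x) y = if D x y then rcons (L f p y) v else L f p y.
  have gLp : [seq g z | z <- p & D z y] = L f p y.
    by apply/eq_in_map => z; rewrite mem_filter => /andP[_ /gp].
  rewrite /L filter_rcons; case: (D x y) => //.
  by rewrite map_rcons gx gLp.
have vf z : z \in p -> f z != v.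
  move=> zp; apply/eqP => fzv.
  have vAz : v \in A (r z) by rewrite -fzv fA.
  case: (eqVneq (r z) (r x)) => [rzx|/disjA].
    by case/negP: vU; apply/imsetP; exists z; rewrite ?inE ?zp ?rzx ?eqxx.
  by rewrite disjoint_subset => /subsetP/(_ _ vAz); rewrite inE vA.
exists g; split.
- move=> y z; rewrite !mem_rcons !inE => /orP[/eqP->|yp] /orP[/eqP->|zp] //.
  + by rewrite gx gp // => /esym/eqP; rewrite (negbTE (vf _ zp)).
  + by rewrite gx gp // => /eqP; rewrite (negbTE (vf _ yp)).
  by rewrite !gp //; apply: injf.
- move=> y; rewrite mem_rcons inE => /orP[/eqP->|yp]; first by rewrite gx.
  by rewrite gp // fA.
- move=> y z; rewrite !mem_rcons !inE => /orP[/eqP->|yp] /orP[/eqP->|zp] D1.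
  + by have := rD _ _ D1; lia.
  + have : x \in p.
      have /splitPr sp := zp; move: sp E => -[p1 p2] E.
      have := topo p1 z (p2 ++ x :: q) x; rewrite E -catA => /(_ erefl D1).
      by rewrite mem_cat => ->.
    by rewrite (negbTE xp).
  + rewrite gx gp //; apply: vL; apply/mapP; exists y => //.
    by rewrite mem_filter D1.
  by rewrite !gp //; apply: fD.
move=> y y0; rewrite gL; case: (boolP (D x y)) => Dxy; last exact: fL.
rewrite size_rcons subnS ltnNge; apply: contra vW => le.
by apply/bigcupP; exists y; rewrite inE.
Qed.

(** * Choosing the blocks along the median order *)

(** A vertex of [A] is dominated by half of the interval formed by [v] and the part of [b] before
    it. That part has length at most |v|/(4d), so at least (1/2)(1 - 1/(4d))|v| in-neighbours lie in
    [v]; averaging then selects a window. *)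
Lemma dense_block (V : finType) (t : rel V) (s p v b q : seq V) (A : {set V}) (d w L : nat) :
  tournament t -> median_order t s -> s = p ++ v ++ b ++ q ->
  {subset A <= b} -> 0 < L -> size v = L * w -> 4 * d * size b <= size v ->
  exists v1 b' v2, [/\ v = v1 ++ b' ++ v2, size b' = w &
    #|A| * w * (4 * d - 1) <= 8 * d * \sum_(x <- b') #|common_out t A [:: x]|].
Proof.
move=> tt ms sE Ab L0 sv le.
pose f x := 8 * d * #|common_out t A [:: x]|.
have sum_f r : \sum_(x <- r) f x = 8 * d * \sum_(x <- r) #|common_out t A [:: x]|.
  by rewrite big_distrr.
have [|v1 [b' [v2 [E sb' K]]]] :=
    @exists_heavy_block V f w (#|A| * w * (4 * d - 1)) L v L0 sv; last first.
  by exists v1, b', v2; split => //; rewrite -sum_f.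
have -> : L * (#|A| * w * (4 * d - 1)) = \sum_(x in A) size v * (4 * d - 1).
  by rewrite sum_nat_const sv; lia.
have -> : \sum_(x <- v) f x = \sum_(x in A) 8 * d * count (t^~ x) v.
  rewrite sum_f -big_distrr /=; congr (_ * _).
  under [in RHS]eq_bigr => x _ do rewrite -sum1_count big_mkcond.
  rewrite exchange_big /=; apply: eq_bigr => y _.
  rewrite -sum1_card big_mkcond [RHS]big_mkcond /=; apply: eq_bigr => x _.
  by rewrite inE /= andbT; case: (x \in A).
apply: leq_sum => x /Ab /splitPr xb; case: xb sE le => b1 b2 sE le.
have := @median_order_indeg _ t s p (v ++ b1) (b2 ++ q) x tt ms.
rewrite sE -!catA => /(_ erefl); rewrite size_cat count_cat.
have := count_size (t^~ x) b1.
move: le; rewrite size_cat /=.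
move: (size v) (size b1) (size b2) (count _ v) (count _ b1) => X y z u u' le u'y indeg.
rewrite mulnBr muln1 leq_subLR.
have := leq_mul (leqnn (4 * d)) (_ : X <= 2 * u + y); nia.
Qed.

(** The least factor for which the hypothesis [32 * (#|B| * s ^ 2) <= m * #|A| ^ 2] of random choice
    follows from the sizes below: 32 comes from there, and the square from [s] being
    [d.+1 * 'C(d, j.+1)]. *)
Definition scale (d : nat) : nat := 32 * d.+1 ^ 2.
(** This is 4^(j+2) times [target_size d j], the loss in random choice with [n] equal to [j.+1]. *)
Definition block_size (d j : nat) : nat := scale d * 16 ^ j.+1 * 'C(d, j).
Definition target_size (d j : nat) : nat := scale d * 4 ^ j * 'C(d, j).
(* Length of the part of the order that must precede B_j for the choice of
   B_(j-1), ..., B_0. *)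
Definition room (d j : nat) : nat :=
  \sum_(i < j) (4 * d * block_size d i.+1 + block_size d i).

Lemma room_le (d : nat) :
  0 < d -> room d d + block_size d d <= 10 * 1024 * d ^ 3 * 17 ^ d.
Proof.
move=> d0; set S := \sum_(i < d.+1) block_size d i.
(* Binomial theorem for (1 + 16)^d. *)
have SE : S = 16 * scale d * 17 ^ d.
  rewrite -[17]/(1 + 16) expnDn big_distrr /=; apply: eq_bigr => i _.
  by rewrite exp1n /block_size expnS; lia.
have : room d d + block_size d d <= (4 * d + 1) * S.
  rewrite /room big_split /= -addnA mulnDl mul1n; apply: leq_add.
    by rewrite -big_distrr leq_mul2l /S big_ord_recl leq_addl orbT.
  by rewrite /S big_ord_recr.
move=> /leq_trans; apply; rewrite SE /scale.
have : (4 * d + 1) * (16 * (32 * d.+1 ^ 2)) <= 10 * 1024 * d ^ 3.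
  have le1 : d.+1 ^ 2 <= (2 * d) ^ 2 by rewrite leq_exp2r; lia.
  have le2 : 4 * d + 1 <= 5 * d by lia.
  apply: leq_trans (leq_mul le2 (leq_mul (leqnn 16) (leq_mul (leqnn 32) le1))) _.
  by rewrite expnMn (expnS d 2); lia.
by move=> H; have := leq_mul H (leqnn (17 ^ d)); rewrite !mulnA.
Qed.

Lemma exists_chain (V : finType) (t : rel V) (d : nat) :
  0 < d -> room d d + block_size d d <= #|V| -> tournament t ->
  exists A : nat -> {set V}, [/\ target_size d 0 <= #|A 0|,
    forall i j, i < j <= d -> [disjoint A i & A j] &
    forall i, i < d ->
      ext_count (poor t (A i.+1) (A i) (d.+1 * 'C(d, i.+1))) i.+1 [::] < 'C(d, i) ^ i.+1].
Proof.
move=> d0 le tt; have [s ms] := exists_median_order t.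
have us : uniq s by rewrite (perm_uniq ms.1) enum_uniq.
have ss : size s = #|V| by rewrite (perm_size ms.1) -cardE.
have blt j : target_size d j <= block_size d j.
  apply: leq_mul => //; apply: leq_mul => //.
  by rewrite -[16]/(4 ^ 2) -expnM leq_exp2l //; lia.
(* Downward induction on [j]: [b] is the block B_j, the sets chosen so far lie in [b ++ q], and [p]
   is long enough for the blocks still to come. *)
suff main k j : j + k = d -> exists p b q (A : nat -> {set V}),
    [/\ s = p ++ b ++ q, size b = block_size d j /\ room d j <= size p,
       {subset A j <= b} /\ target_size d j <= #|A j|,
       forall i, j <= i <= d -> {subset A i <= b ++ q} &
       (forall i i', j <= i -> i < i' <= d -> [disjoint A i & A i']) /\
       forall i, j <= i -> i < d ->
         ext_count (poor t (A i.+1) (A i) (d.+1 * 'C(d, i.+1))) i.+1 [::] < 'C(d, i) ^ i.+1].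
  have [p [b [q [A [_ _ [_ cA] _ [dA eA]]]]]] := main d 0 (add0n d).
  by exists A; split => // [i j|i]; [apply: dA | apply: eA].
elim: k j => [|k IH] j.
  rewrite addn0 => ->.
  exists (take (size s - block_size d d) s), (drop (size s - block_size d d) s), [::].
  (* [A d] is the entire last block of the order; the values at other indices are placeholders. *)
  exists (fun=> [set x in drop (size s - block_size d d) s]); split.
  - by rewrite cats0 cat_take_drop.
  - by rewrite size_drop size_take ss; case: ltnP; lia.
  - split => [x|]; first by rewrite inE.
    rewrite cardsE (card_uniqP (drop_uniq _ us)) size_drop ss subKn //.
    by apply: leq_trans le; apply: leq_addl.
  - by move=> i _ x; rewrite inE cats0.
  by split => i *; lia.
rewrite addnS => jk; have jd : j < d by lia.
have [p [b [q [A [sE [sb sp] [Ab cA] Abq [dA eA]]]]]] := IH j.+1 jk.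
set w := block_size d j.
have w0 : 0 < w by rewrite /w /block_size /scale !muln_gt0 !expn_gt0 bin_gt0 (ltnW jd).
(* Rounding up to a multiple of [w] costs at most [w], the summand [block_size d i] of [room]. *)
pose L := (4 * d * size b %/ w).+1.
have Lw1 : 4 * d * size b <= L * w by rewrite ltnW // ltn_ceil.
have Lw2 : L * w <= 4 * d * size b + w by rewrite /L [_.+1 * w]mulSn addnC leq_add2r leq_divM.
have Lp : room d j + L * w <= size p.
  apply: leq_trans sp; rewrite /room big_ord_recr /= leq_add2l.
  by rewrite -sb.
pose v := drop (size p - L * w) p.
have sv : size v = L * w by rewrite size_drop; lia.
have sE1 : s = take (size p - L * w) p ++ v ++ b ++ q.
  by rewrite catA cat_take_drop.
have := @dense_block V t s _ v b q (A j.+1) d w L tt ms sE1 Ab isT sv.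
rewrite sv => /(_ Lw1) [v1 [b' [v2 [vE sb' dens]]]].
have ub' : uniq b'.
  by move: us; rewrite sE1 vE !cat_uniq; case: (uniq b'); rewrite ?andbF.
have [||||||B [BB cB eB]] := @dependent_random_choice V t (A j.+1) [set x in b'] d j.+1
   (d.+1 * 'C(d, j.+1)) 'C(d, j) (target_size d j).
- by [].
- by rewrite muln_gt0 bin_gt0.
- by rewrite /target_size /scale !muln_gt0 !expn_gt0 bin_gt0 (ltnW jd).
- rewrite cardsE (card_uniqP ub') sb' /w /block_size /target_size.
  by rewrite -[16]/(4 * 4) expnMn !(expnS 4); lia.
- rewrite cardsE (card_uniqP ub') sb'.
  rewrite (eq_bigl (mem b')) => [|x]; last by rewrite inE.
  by rewrite -big_uniq.
- rewrite cardsE (card_uniqP ub') sb'.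
  apply: leq_trans (leq_mul (leqnn _) (_ : target_size d j.+1 ^ 2 <= _)); last by rewrite leq_exp2r.
  have E : (4 ^ j.+1) ^ 2 = 16 ^ j.+1 by rewrite -expnM mulnC expnM.
  have sc : scale d = 32 * d.+1 ^ 2 by [].
  rewrite /w /block_size /target_size; move: (scale d) sc => c sc.
  rewrite !expnMn E -[c ^ 2]mulnn sc.
  by move: (16 ^ _) 'C(d, j) ('C(d, j.+1) ^ 2) (d.+1 ^ 2) => x y z u; lia.
have Bb' : {subset B <= b'} by move=> x /(subsetP BB); rewrite inE.
exists (take (size p - L * w) p ++ v1), b', (v2 ++ b ++ q).
exists (fun i => if i == j then B else A i).
have inbq i : j <= i <= d -> {subset (if i == j then B else A i) <= b' ++ v2 ++ b ++ q}.
  move=> ij x; case: eqP => [_ /Bb' xb|ne xA]; first by rewrite mem_cat xb.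
  by rewrite catA mem_cat (Abq i) ?orbT //; lia.
split => //.
- by rewrite sE1 vE -!catA.
- by split => //; rewrite size_cat size_take; case: ltnP; lia.
- by rewrite eqxx.
split => [i i' ji /andP[ii' i'd]|i ji id].
  have -> : (i' == j) = false by lia.
  case: eqP => [_|ne]; last by apply: dA; lia.
  rewrite disjoint_subset; apply/subsetP => x /Bb' xb; rewrite inE.
  apply/negP => xA; have xbq : x \in b ++ q by apply: (Abq i') xA; lia.
  move: us; rewrite sE1 vE -!catA catA cat_uniq => /and3P[_ _].
  rewrite catA cat_uniq => /and3P[_ /hasPn /(_ _ xbq)].
  by rewrite mem_cat /= xb.
have -> : (i.+1 == j) = false by lia.
by case: eqP => [->|ne] //; apply: eA; lia.
Qed.

Lemma hypercube_in_tournament (V : finType) (t : rel V) (d : nat) :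
  0 < d -> room d d + block_size d d <= #|V| -> tournament t ->
  contains_copy (oriented_hypercube d) t.
Proof.
move=> d0 le tt; have [A [cA dA eA]] := exists_chain d0 le tt.
have sz (u : {ffun 'I_d -> bool}) : #|support_set u| <= d.
  by apply: leq_trans (max_card _) _; rewrite card_ord.
have v0 : V.
  have : 0 < #|V| by apply: leq_trans le; rewrite addn_gt0 /block_size !muln_gt0 expn_gt0 binn orbT.
  by move=> V0; apply: (enum_val (Ordinal V0)).
(* [s i] is (d+1) C(d,i): C(d,i) for the layer itself, and C(d,i) forbidden images for each of at
   most d out-neighbours. *)
apply: (graded_embedding (r := fun u => #|support_set u|) (A := A)
   (m := fun i => 'C(d, i)) (s := fun i => d.+1 * 'C(d, i)) (k := d)) => //.
- exact: oriented_hypercube_rank.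
- exact: oriented_hypercube_indegree.
- exact: oriented_hypercube_outdegree.
- by move=> u; rewrite card_hypercube_layer mulSn.
- move=> u v; case: (ltngtP #|support_set u|) => // lt _.
    by apply: dA; rewrite lt sz.
  by rewrite disjoint_sym; apply: dA; rewrite lt sz.
- apply: leq_trans cA; rewrite /target_size /scale !bin0 !muln1 expnS expn1.
  by rewrite mulnA leq_pmull.
by move=> u i ui; apply: eA; rewrite -ui.
Qed.

(** Well-ordering of the naturals, the property being decided classically. *)
Lemma is_oriented_ramsey_le (T : finType) (D : rel T) (N : nat) :
  all_tournaments_contain D N -> exists2 M, is_oriented_ramsey D M & M <= N.
Proof.
move=> DN; have exN : exists n, `[< all_tournaments_contain D n >] by exists N; apply/asboolP.
case: (ex_minnP exN) => M /asboolP DM minM; exists M; last by apply/minM/asboolP.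
by split => // n /asboolP; apply: minM.
Qed.

Import Order.TTheory GRing.Theory Num.Theory.
Local Open Scope ring_scope.

Theorem theorem1p5 (R : realType) :
  exists C : R, 0 < C /\
    forall d : nat, (1 <= d)%N ->
      exists N : nat,
        is_oriented_ramsey (oriented_hypercube d) N /\
        N%:R <= C * d%:R ^+ 3 * 17%:R ^+ d.
Proof.
exists (10 * 1024)%N%:R; split => [|d d0]; first by rewrite ltr0n.
have [|N DN leN] := @is_oriented_ramsey_le _ (oriented_hypercube d) (room d d + block_size d d).
  by move=> V t cV; apply: hypercube_in_tournament; rewrite ?cV.
exists N; split => //.
by rewrite -!natrX -!natrM ler_nat (leq_trans leN) // room_le.
Qed.
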